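(* Let $X$ be a metric space that is a union of countably many compact subsets, let $A$ be a (unital, complex) Banach algebra and $G$ its group of invertible elements, and let $\mathcal{C}^G$ be the sheaf of germs of continuous maps with values in $G$. Let $U_1,\ldots,U_n$ ($n\in\mathbb{N}$, $n\ge 1$) be open sets in $X$ such that the intersections $(U_1\cup\ldots\cup U_k)\cap U_{k+1}$, $k=1,\ldots,n-1$, are contractible. Then $H^1(\mathcal{U},\mathcal{C}^G)=1$ for the covering $\mathcal{U}:=(U_k)_{1\le k\le n}$ of $U_1\cup\ldots\cup U_n$.
   Context: A metric space $Y$ is called contractible if there is a continuous map $H:Y\times[0,1]\to Y$ and a point $x_0\in Y$ with $H(x,0)=x$ and $H(x,1)=x_0$ for all $x\in Y$. The sections of $\mathcal{C}^G$ over an open set $U$ are the continuous maps $U\to G$, a group under pointwise multiplication; $f^{-1}$ denotes the pointwise inverse. For the covering $\mathcal{U}=(U_k)_{1\le k\le n}$, a 1-cocycle is a family $(f_{ij})_{1\le i,j\le n}$ of continuous maps $f_{ij}:U_i\cap U_j\to G$ with $f_{ij}f_{jk}=f_{ik}$ on $U_i\cap U_j\cap U_k$ for all $i,j,k$. Two 1-cocycles $f,g$ are equivalent if there are continuous maps $h_i:U_i\to G$ with $g_{ij}=h_i^{-1}f_{ij}h_j$ on $U_i\cap U_j$ for all $i,j$. $H^1(\mathcal{U},\mathcal{C}^G)$ is the set of equivalence classes of 1-cocycles, with distinguished element $1$ the class of the cocycles of the form $f_{ij}=h_i^{-1}h_j$. ''$H^1(\mathcal{U},\mathcal{C}^G)=1$''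 means that $1$ is its only element, i.e. every 1-cocycle is of the form $f_{ij}=h_i^{-1}h_j$. *)

(* Defs.v *)
From HB Require Import structures.
From mathcomp Require Import all_boot all_order all_algebra.
From mathcomp Require Import all_classical all_reals all_analysis.
From mathcomp Require Export complex.

Set Implicit Arguments.
Unset Strict Implicit.
Unset Printing Implicit Defensive.

Import Order.TTheory GRing.Theory Num.Theory.
Import numFieldNormedType.Exports.

Local Open Scope classical_set_scope.
Local Open Scope ring_scope.

(* Unital Banach algebras over K.  The product is given by fields of the mixin
   because a join of the ring and normed-module structures would have to sit
   below numDomainType in the hierarchy.  The zero algebra is allowed, and no
   normalization `|1| = 1 is required. *)
HB.mixin Record CompleteNormedModule_isBanachAlgebra (K : numFieldType) A
    & CompleteNormedModule K A := {
  bone : A ;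
  bmul : A -> A -> A ;
  bmulA : associative bmul ;
  bmul1x : left_id bone bmul ;
  bmulx1 : right_id bone bmul ;
  bmulDl : left_distributive bmul +%R ;
  bmulDr : right_distributive bmul +%R ;
  bscaleAl : forall (a : K) (x y : A), a *: bmul x y = bmul (a *: x) y ;
  bscaleAr : forall (a : K) (x y : A), a *: bmul x y = bmul x (a *: y) ;
  bnormM : forall x y : A, `|bmul x y| <= `|x| * `|y|
}.

#[short(type="banachAlgType")]
HB.structure Definition BanachAlgebra (K : numFieldType) :=
  {A of CompleteNormedModule K A & CompleteNormedModule_isBanachAlgebra K A}.

HB.instance Definition _ (K : numFieldType) (A : banachAlgType K) :=
  GRing.Zmodule_isPzRing.Build (BanachAlgebra.sort A)
    bmulA bmul1x bmulx1 bmulDl bmulDr.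

Section InvertibleElements.
Context {A : pzRingType}.

Definition is_inverse (x y : A) : Prop := y * x = 1 /\ x * y = 1.

Definition invertibles : set A := [set x | exists y, is_inverse x y].

(* The inverse of x, or 0 when x is not invertible. *)
Definition ginv (x : A) : A := xget 0 [set y | is_inverse x y].

End InvertibleElements.

(* Only the values of H on Y x [0, 1] matter. *)
Definition contractible (R : realType) (Y : topologicalType) : Prop :=
  exists (H : Y * R -> Y) (x0 : Y),
    [/\ {within [set: Y] `*` `[0, 1], continuous H},
        forall x, H (x, 0) = x
      & forall x, H (x, 1) = x0].

Definition sigma_compact (X : topologicalType) : Prop :=
  exists K : nat -> set X,
    (forall m, compact (K m)) /\ \bigcup_m K m = [set: X].

Section Cohomology.
Context {R : realType} {X : topologicalType} {A : banachAlgType R[i]}.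

(* Sections of the sheaf over V, represented by total maps X -> A of which only
   the restriction to V matters. *)
Definition is_section (V : set X) (f : X -> A) : Prop :=
  {within V, continuous f} /\ (forall x, V x -> invertibles (f x)).

Context {n : nat}.
Implicit Types (U : 'I_n -> set X) (f g : 'I_n -> 'I_n -> X -> A).

Definition is_cocycle U f : Prop :=
  (forall i j, is_section (U i `&` U j) (f i j)) /\
  (forall i j k x, (U i `&` U j `&` U k) x -> f i j x * f j k x = f i k x).

Definition cocycle_equiv U f g : Prop :=
  exists h : 'I_n -> X -> A,
    (forall i, is_section (U i) (h i)) /\
    (forall i j x, (U i `&` U j) x ->
       g i j x = ginv (h i x) * f i j x * h j x).

(* Two families that agree on the overlaps are equivalent (take h = 1), so the
   junk values outside the overlaps do not affect the set of classes. *)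
Definition cocycle_class U f : set ('I_n -> 'I_n -> X -> A) :=
  [set g | is_cocycle U g /\ cocycle_equiv U f g].

Definition H1 U : set (set ('I_n -> 'I_n -> X -> A)) :=
  [set cocycle_class U f | f in [set f | is_cocycle U f]].

Definition H1_one U : set ('I_n -> 'I_n -> X -> A) :=
  [set f | is_cocycle U f /\
     exists h : 'I_n -> X -> A,
       (forall i, is_section (U i) (h i)) /\
       (forall i j x, (U i `&` U j) x -> f i j x = ginv (h i x) * h j x)].

End Cohomology.

(* Main.v *)
Require Import Defs.
From mathcomp Require Import all_boot all_order all_algebra.
From mathcomp Require Import all_classical all_reals all_analysis.
From mathcomp Require Import lra.

Import Order.TTheory GRing.Theory Num.Theory.
Import numFieldNormedType.Exports.

Local Open Scope classical_set_scope.
Local Open Scope ring_scope.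

(** A cocycle is trivialized one open set at a time, and each step reduces to a
    multiplicative splitting problem for a single function on
    (U_1 u ... u U_k) n U_(k+1).

    The splitting ([splitting]): let W1, W2 be open with contractible
    intersection W and let f : W -> G be continuous.  Composing f with the
    contraction H of W gives a homotopy F(x, t) = f(H(x, t)) inside G from f to
    a constant c.  In a metric space there is a continuous
    chi : W1 u W2 -> [0, 1] which is 0 near W1 \ W2 and 1 near W2 \ W1
    ([transition_function]).  Then g2(x) = F(x, chi(x)) equals c near W2 \ W1
    and thus extends continuously to W2, while it equals f near W1 \ W2, so
    that g1 = g2 f^-1 equals 1 there and extends continuously to W1.  Hence
    g1 f = g2 on W with g1, g2 sections over W1 and W2.

    The induction ([cocycle_trivial_upto]): suppose h_i f_ij = h_j for
    i, j <= k.  The functions h_i f_(i,k+1), i <= k, agree on overlaps by the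
    cocycle identity, hence define one section F over
    (U_1 u ... u U_k) n U_(k+1).  If g1 F = g2 is a splitting of F, then the
    sections g1 h_i (i <= k) together with g2 over U_(k+1) trivialize f up to
    k + 1.

    Two trivial cocycles are equivalent ([H1_one_class]), so a set of classes
    all of whose cocycles are trivial has exactly one element. *)

(** * Invertible elements of a ring *)

Section Inverses.
Context {A : pzRingType}.
Implicit Types x y : A.

Lemma is_inverse_unique x y z : is_inverse x y -> is_inverse x z -> y = z.
Proof. by move=> [yx _] [_ xz]; rewrite -[y]mulr1 -xz mulrA yx mul1r. Qed.

Lemma ginvP x : invertibles x -> is_inverse x (ginv x).
Proof. by move=> [y xy]; exact: (@xgetI _ _ _ y xy). Qed.

Lemma ginv_invertible x : invertibles x -> invertibles (ginv x).
Proof. by move=> /ginvP[yx xy]; exists x; split. Qed.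

Lemma invertiblesM x y : invertibles x -> invertibles y -> invertibles (x * y).
Proof.
move=> [x' [x'x xx']] [y' [y'y yy']]; exists (y' * x'); split.
- by rewrite mulrA -[y' * x' * x]mulrA x'x mulr1.
- by rewrite mulrA -[x * y * y']mulrA yy' mulr1.
Qed.

Lemma invertibles1 : invertibles (1 : A).
Proof. by exists 1; split; rewrite mulr1. Qed.

Lemma ginv_mulP x y z : invertibles x -> z = ginv x * y <-> x * z = y.
Proof.
move=> /ginvP[x'x xx']; split=> [->|<-].
- by rewrite mulrA xx' mul1r.
- by rewrite mulrA x'x mul1r.
Qed.

Lemma mulI_invertible {x y z} : invertibles x -> x * y = x * z -> y = z.
Proof. by move=> ux /(ginv_mulP _ _ _ ux) ->; apply/esym/ginv_mulP. Qed.

End Inverses.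

(** * Continuity of the product and of inversion *)

Section BanachAlgebraContinuity.
Context {K : numFieldType} {A : banachAlgType K}.

Lemma normM_le (x y : A) : `|x * y| <= `|x| * `|y|.
Proof. exact: bnormM. Qed.

Lemma cvg_dist_squeeze {T : Type} (F : set_system T) {FF : Filter F}
    (f : T -> A) (a : A) (g : T -> K) :
  (\forall t \near F, `|f t - a| <= g t) -> g @ F --> 0 -> f @ F --> a.
Proof.
move=> fg g0; apply/cvgrPdist_lt => e e0; near=> t.
have fgt : `|f t - a| <= g t by near: t.
rewrite distrC (le_lt_trans fgt)// -[g t]ger0_norm ?(le_trans _ fgt)//.
by near: t; move/cvgr0Pnorm_lt : g0; exact.
Unshelve. all: by end_near. Qed.

Lemma cvg_dist0 {T : Type} (F : set_system T) {FF : Filter F} (f : T -> A)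
    (a : A) : f @ F --> a -> (fun t => `|f t - a|) @ F --> (0 : K).
Proof.
move=> fa; rewrite -(normr0 A) -(subrr a); apply: cvg_norm.
exact: cvgB fa (cvg_cst _).
Qed.

(** From fg - ab = (f - a)(g - b) + a (g - b) + (f - a) b and the
    submultiplicativity of the norm. *)
Lemma cvg_bmul {T : Type} (F : set_system T) {FF : Filter F} (f g : T -> A)
    (a b : A) :
  f @ F --> a -> g @ F --> b -> (fun t => f t * g t) @ F --> a * b.
Proof.
move=> /cvg_dist0 fa /cvg_dist0 gb.
apply: (@cvg_dist_squeeze _ _ _ _ _
  (fun t => `|f t - a| * `|g t - b| + `|a| * `|g t - b| + `|f t - a| * `|b|)).
  near=> t.
  have -> : f t * g t - a * b =
      (f t - a) * (g t - b) + a * (g t - b) + (f t - a) * b.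
    by rewrite -mulrDl subrK mulrBr mulrBl addrA subrK.
  rewrite (le_trans (ler_normD _ _))// lerD ?normM_le//.
  by rewrite (le_trans (ler_normD _ _))// lerD ?normM_le.
have -> : (0 : K) = 0 * 0 + `|a| * 0 + 0 * `|b| by rewrite !(mulr0, mul0r) !addr0.
apply: cvgD; last exact: cvgM fa (cvg_cst _).
by apply: cvgD; [exact: cvgM fa gb|exact: cvgM (cvg_cst _) gb].
Unshelve. all: by end_near. Qed.

(** With y = g t the inverse of x = f t, one has y - b = y (a - x) b.  As soon as
    |x - a| |b| <= 1/2 this gives |y| <= |b| + |y| / 2, so |y| <= 2 |b|, and
    then |y - b| <= 2 |b|^2 |x - a|. *)
Lemma cvg_inverse {T : Type} (F : set_system T) {FF : Filter F} (f g : T -> A)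
    (a b : A) :
  is_inverse a b -> (\forall t \near F, is_inverse (f t) (g t)) ->
  f @ F --> a -> g @ F --> b.
Proof.
move=> [_ ab] fg /cvg_dist0 fa.
have fab : (fun t => `|f t - a| * `|b|) @ F --> (0 : K).
  by rewrite -(mul0r `|b|); exact: cvgM fa (cvg_cst _).
apply: (@cvg_dist_squeeze _ _ _ _ _ (fun t => 2 * `|b| * (`|f t - a| * `|b|))).
  near=> t.
  have [gf _] : is_inverse (f t) (g t) by near: t.
  have small : `|f t - a| * `|b| <= 2^-1.
    rewrite -[leLHS]ger0_norm ?mulr_ge0//; near: t.
    by move/cvgr0Pnorm_le : fab; apply; rewrite invr_gt0.
  have le_gb : `|g t - b| <= `|g t| * (`|f t - a| * `|b|).
    have -> : g t - b = g t * ((a - f t) * b).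
      by rewrite mulrBl ab mulrBr mulr1 mulrA gf mul1r.
    rewrite (le_trans (normM_le _ _))// ler_wpM2l//.
    by rewrite (le_trans (normM_le _ _))// distrC.
  have le_g : `|g t| <= 2 * `|b|.
    rewrite mulrC -ler_pdivrMr// -(lerD2r (`|g t| / 2)) -mulrDl -mulr2n.
    rewrite -[_ *+ 2]mulr_natr mulfK ?pnatr_eq0//.
    rewrite -lerBlDl (le_trans (lerB_dist _ _))// (le_trans le_gb)//.
    exact: ler_wpM2l.
  by rewrite (le_trans le_gb)// ler_wpM2r// mulr_ge0.
by rewrite -(mulr0 (2 * `|b|)); exact: cvgM (cvg_cst _) fab.
Unshelve. all: by end_near. Qed.

End BanachAlgebraContinuity.

(** * The group of sections over an open set *)

Section Sections.
Context {R : realType} {X : topologicalType} {A : banachAlgType R[i]}.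
Implicit Types (V : set X) (f g : X -> A).

Lemma is_sectionP V f : open V ->
  is_section V f <->
  forall x, V x -> {for x, continuous f} /\ invertibles (f x).
Proof.
move=> oV; rewrite /is_section continuous_open_subspace//; split.
- by move=> [cf uf] x Vx; split; [exact/cf/mem_set|exact: uf].
- move=> h; split=> [x /set_mem Vx|x Vx]; [exact: (h x Vx).1|exact: (h x Vx).2].
Qed.

Lemma is_section_mul V f g : open V ->
  is_section V f -> is_section V g -> is_section V (fun x => f x * g x).
Proof.
move=> oV /(is_sectionP _ _ oV) hf /(is_sectionP _ _ oV) hg.
apply/is_sectionP => // x Vx; have [cf uf] := hf x Vx; have [cg ug] := hg x Vx.
by split; [exact: cvg_bmul|exact: invertiblesM].
Qed.

Lemma is_section_ginv V f : open V ->
  is_section V f -> is_section V (fun x => ginv (f x)).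
Proof.
move=> oV /(is_sectionP _ _ oV) hf.
apply/is_sectionP => // x Vx; have [cf uf] := hf x Vx.
split; last exact: ginv_invertible.
apply: cvg_inverse cf; first exact: ginvP.
have : nbhs x V by exact: open_nbhs_nbhs.
by apply: filterS => y /hf[_ /ginvP].
Qed.

Lemma is_section1 V : is_section V (fun=> 1 : A).
Proof.
split=> [|x _]; last exact: invertibles1.
by apply: continuous_subspaceT => x; exact: cvg_cst.
Qed.

Lemma is_sectionS V W f : W `<=` V -> is_section V f -> is_section W f.
Proof.
move=> WV [cf uf]; split=> [|x /WV]; last exact: uf.
exact: continuous_subspaceW cf.
Qed.

End Sections.

(** * Transition functions in a metric space *)

Section Separation.
Context {R : realType} {X : metricType R}.

(** The distance to the complement, or 1 when the complement is empty. *)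
Lemma open_positivity_set (W : set X) : open W ->
  exists d : X -> R,
    [/\ continuous d, forall x, 0 <= d x & forall x, W x <-> 0 < d x].
Proof.
move=> oW; have [W0|/set0P[a0 Wa0]] := eqVneq (~` W) set0.
  exists (fun=> 1); split=> [x|x|x]; [exact: cvg_cst|exact: ler01|].
  by split=> // _; rewrite -[W]setCK W0 setC0.
have fin x : edist_inf (~` W) x \is a fin_num.
  rewrite (ge0_fin_numE (edist_inf_ge0 _ _)).
  apply: (@le_lt_trans _ _ (edist (x, a0))).
    by apply: ereal_inf_lbound; exists a0.
  rewrite -(ge0_fin_numE (edist_ge0 _)); apply/edist_finP.
  exists (mdist x a0 + 1) => /=.
    by rewrite ltr_wpDl// mdist_ge0.
  by rewrite ballEmdist/= ltrDl.
exists (fine \o edist_inf (~` W)); split=> [x|x|x] /=.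
- have := @edist_inf_continuous _ _ (~` W) x.
  by rewrite /continuous_at -[X in _ --> X]fineK// => /fine_cvgP[].
- exact/fine_ge0/edist_inf_ge0.
- split=> [Wx|]; last first.
    by apply: contraPP => Wx; rewrite edist_inf0//= ltxx.
  have [e /= e0 eW] := (nbhs_ballP x W).1 (open_nbhs_nbhs (conj oW Wx)).
  rewrite -lte_fin fineK// (@lt_le_trans _ _ e%:E)//.
  apply: le_ereal_inf_tmp => _ [a Wa <-]; rewrite leNgt.
  by apply/negP => /edist_lt_ball /eW.
Qed.

(** With a and b positive exactly on W2 and W1, the quotient a / (a + b) is
    continuous on W1 u W2, is 0 on W1 \ W2 and 1 on W2 \ W1.  Truncating
    3 a / (a + b) - 1 to [0, 1] makes these values hold on neighbourhoods. *)
Lemma transition_function (W1 W2 : set X) : open W1 -> open W2 ->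
  exists chi : X -> R,
    [/\ forall x, 0 <= chi x <= 1,
        forall x, (W1 `|` W2) x -> {for x, continuous chi},
        forall x, (W1 `\` W2) x -> \forall y \near x, chi y = 0
      & forall x, (W2 `\` W1) x -> \forall y \near x, chi y = 1].
Proof.
move=> /open_positivity_set[b [cb b0 bW]] /open_positivity_set[a [ca a0 aW]].
pose r x := 3 * (a x / (a x + b x)) - 1.
have cr x : (W1 `|` W2) x -> {for x, continuous r}.
  move=> Wx; apply: cvgB; last exact: cvg_cst.
  apply: cvgM; first exact: cvg_cst.
  apply: cvgM; first exact: ca.
  apply: cvgV; last by apply: cvgD; [exact: ca|exact: cb].
  rewrite gt_eqF//; case: Wx => [/bW bx|/aW ax].
    by rewrite addrC ltr_pwDl.
  by rewrite ltr_pwDl.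
have outside (d : X -> R) (W : set X) x :
    (forall x, 0 <= d x) -> (forall x, W x <-> 0 < d x) ->
    ~ W x -> d x = 0 :> R.
  move=> d0 dW Wx; apply/eqP; rewrite eq_le d0 andbT leNgt.
  by apply/negP => /dW.
exists (fun x => Num.max 0 (Num.min 1 (r x))).
split=> [x|x Wx|x [W1x W2x]|x [W2x W1x]].
- by rewrite le_max lexx/= ge_max ler01 ge_min lexx.
- apply: (@continuous_max _ _ (fun=> 0) (fun y => Num.min 1 (r y))).
    exact: cvg_cst.
  by apply: (@continuous_min _ _ (fun=> 1) r); [exact: cvg_cst|exact: cr].
- have rx : r x < 0 by rewrite /r (outside a W2 x a0 aW W2x) mul0r mulr0 sub0r oppr_lt0.
  have : \forall y \near x, r y < 0 by apply: cvgr_lt rx; apply: cr; left.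
  apply: filterS => y ry; apply/max_idPl; rewrite ge_min (ltW ry) orbT//.
- have rx : 1 < r x.
    rewrite /r (outside b W1 x b0 bW W1x) addr0 divff ?gt_eqF//; [lra|exact/aW].
  have : \forall y \near x, 1 < r y by apply: cvgr_gt rx; apply: cr; right.
  apply: filterS => y ry; rewrite (min_idPl (ltW ry)); apply/max_idPr; exact: ler01.
Qed.

End Separation.

(** * Splitting a section over a contractible intersection *)

Section Splitting.
Context {R : realType} {X : metricType R} {A : banachAlgType R[i]}.

(** The one place where contractibility enters: sliding along the homotopy
    from f to a constant, with time given by a transition function, joins f
    near W1 \ W2 to the constant near W2 \ W1. *)
Lemma splitting (W1 W2 : set X) (f : X -> A) : open W1 -> open W2 ->
  contractible R (set_type (W1 `&` W2)) -> is_section (W1 `&` W2) f ->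
  exists g1 g2 : X -> A,
    [/\ is_section W1 g1, is_section W2 g2
      & forall x, (W1 `&` W2) x -> g1 x * f x = g2 x].
Proof.
set W := W1 `&` W2 => oW1 oW2 [H [y0 [cH H0 H1]]] sf.
have oW : open W by exact: openI.
have /(is_sectionP _ _ oW) sfW := sf.
have [chi [chi01 cchi chi0 chi1]] := transition_function _ _ oW1 oW2.
have valW (y : set_type W) : W (set_val y) by exact: set_valP.
(* Outside W, phi takes the value y0, the end point of the contraction, so that
   g2 is defined everywhere and equals f y0 wherever chi = 1. *)
pose phi x : set_type W :=
  if pselect (W x) is left Wx then exist _ x (mem_set Wx) else y0.
have phiK x : W x -> set_val (phi x) = x.
  by rewrite /phi; case: pselect.
pose g2 x := f (set_val (H (phi x, chi x))).
have ug2 x : invertibles (g2 x) by exact: (sfW _ (valW _)).2.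
(* The topology of the subtype is the initial one for the inclusion, and phi
   followed by the inclusion is the identity near a point of the open set W. *)
have cphi x : W x -> {for x, continuous phi}.
  move=> Wx V [_ [[V' oV' <-]] /= V'x V'V].
  have : \forall y \near x, V' y /\ W y.
    by apply: filterI; apply: open_nbhs_nbhs; split=> //; rewrite -(phiK x).
  by apply: filterS => y [V'y Wy]; apply: V'V; rewrite /= phiK.
have cHphi x : W x -> {for x, continuous (fun y => H (phi y, chi y))}.
  move=> Wx V VH.
  have Dphi y : ([set: set_type W] `*` `[0, 1]) (phi y, chi y).
    by split=> //=; rewrite in_itv/= chi01.
  have cp : (phi y, chi y) @[y --> x] --> (phi x, chi x).
    have cphix : phi y @[y --> x] --> phi x by exact: cphi.
    have cchix : chi y @[y --> x] --> chi x by apply: cchi; left; case: Wx.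
    exact: (cvg_pair cphix cchix).
  have /subspace_continuousP/(_ _ (Dphi x) V VH) hV := cH.
  have : \forall y \near x, ([set: set_type W] `*` `[0, 1]) (phi y, chi y) ->
      V (H (phi y, chi y)) by exact: cp _ hV.
  by apply: filterS => y; exact.
have sg2 : is_section W2 g2.
  apply/is_sectionP => // x W2x; split; last exact: ug2.
  have [W1x|W1x] := pselect (W1 x).
    have Wx : W x by [].
    apply: (@continuous_comp _ _ _ _ f); last exact: (sfW _ (valW _)).1.
    apply: (@continuous_comp _ _ _ _ set_val); first exact: cHphi.
    exact: initial_continuous.
  apply: (@near_cst_continuous _ _ (f (set_val y0))).
  by have := chi1 x (conj W2x W1x); apply: filterS => y chiy; rewrite /g2 chiy H1.
have sginvf := is_section_ginv _ _ oW sf.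
pose g1 x := if pselect (W x) is left _ then g2 x * ginv (f x) else 1.
have g1E x : W x -> g1 x = g2 x * ginv (f x) by rewrite /g1; case: pselect.
exists g1, g2; split=> // [|x Wx]; last first.
  by have [fK _] := ginvP _ (sfW _ Wx).2; rewrite g1E// -mulrA fK mulr1.
have /(is_sectionP _ _ oW) sW : is_section W (fun x => g2 x * ginv (f x)).
  by apply: is_section_mul => //; apply: is_sectionS sg2; exact: subIsetr.
apply/is_sectionP => // x W1x; split; last first.
  rewrite /g1; case: pselect => [Wx|_]; [exact: (sW x Wx).2|exact: invertibles1].
have [W2x|W2x] := pselect (W2 x).
  have Wx : W x by [].
  rewrite /prop_for /continuous_at g1E//.
  apply: cvg_trans (sW x Wx).1; apply: near_eq_cvg.
  by have := open_nbhs_nbhs (conj oW Wx); apply: filterS => y /g1E.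
apply: (@near_cst_continuous _ _ (1 : A)).
have := chi0 x (conj W1x W2x); apply: filterS => y chiy.
rewrite /g1; case: pselect => // Wy.
by rewrite /g2 chiy H0 phiK//; exact: (ginvP _ (sfW _ Wy).2).2.
Qed.

End Splitting.

(** * Trivializing a cocycle *)

Section Cocycles.
Context {R : realType} {X : metricType R} {A : banachAlgType R[i]} {n : nat}.
Context (U : 'I_n -> set X).
Hypothesis oU : forall i, open (U i).

Lemma cocycle_diag (f : 'I_n -> 'I_n -> X -> A) i x :
  is_cocycle U f -> U i x -> f i i x = 1.
Proof.
move=> [sf cf] Uix; have [_ /(_ x (conj Uix Uix)) u] := sf i i.
by apply: (mulI_invertible u); rewrite cf// mulr1.
Qed.

(** Triviality is used in the form h_i f_ij = h_j, which needs no inverses. *)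
Lemma cocycle_trivial_upto (f : 'I_n -> 'I_n -> X -> A) (k : nat) :
  (forall k : 'I_n, (0 < k)%N ->
     contractible R
       (set_type ((\bigcup_(j in [set j : 'I_n | (j < k)%N]) U j) `&` U k))) ->
  is_cocycle U f -> (k <= n)%N ->
  exists h : 'I_n -> X -> A,
    (forall i : 'I_n, (i < k)%N -> is_section (U i) (h i)) /\
    (forall (i j : 'I_n) x, (i < k)%N -> (j < k)%N -> (U i `&` U j) x ->
       h i x * f i j x = h j x).
Proof.
move=> hcontr cf; elim: k => [|k IHk] kn; first by exists (fun _ _ => 1).
have [h [sh hf]] := IHk (ltnW kn).
pose m := Ordinal kn.
have ltS (i : 'I_n) : (i < k.+1)%N -> (i < k)%N \/ i = m.
  by rewrite ltnS leq_eqVlt => /orP[/eqP ik|]; [right; exact/val_inj|left].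
have [k0|k0] := posnP k.
  (* For the first open set there is nothing to split: f_00 = 1. *)
  exists (fun _ _ => 1); split=> [i _|i j x /ltS + /ltS]; first exact: is_section1.
  by rewrite k0 !ltn0 => -[//|->] [//|->] [Ux _]; rewrite cocycle_diag// mulr1.
set W := \bigcup_(j in [set j : 'I_n | (j < k)%N]) U j.
have oW : open W by exact: bigcup_open.
(* F glues the h_i f_im, i < k; its value does not depend on the index picked. *)
pose F x := if [pick i : 'I_n | (i < k)%N && `[<U i x>]] is Some i
            then h i x * f i m x else 1.
have FE (i : 'I_n) x : (i < k)%N -> U i x -> U m x -> F x = h i x * f i m x.
  move=> ik Ui Um; rewrite /F; case: pickP => [j /andP[jk /asboolP Uj]|/(_ i)].
    by rewrite -(hf i j)// -mulrA cf.2.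
  by rewrite ik/=; move/asboolP.
have sF : is_section (W `&` U m) F.
  apply/is_sectionP => [|x [[i /= ik Ui] Um]]; first exact: openI.
  have oUim : open (U i `&` U m) by exact: openI.
  have /(is_sectionP _ _ oUim)/(_ x (conj Ui Um))[cx ux] :
      is_section (U i `&` U m) (fun x => h i x * f i m x).
    apply: is_section_mul (cf.1 i m) => //.
    by apply: is_sectionS (sh i ik); exact: subIsetl.
  rewrite /prop_for /continuous_at (FE i)//; split=> //.
  apply: cvg_trans cx; apply: near_eq_cvg.
  have := open_nbhs_nbhs (conj oUim (conj Ui Um)).
  by apply: filterS => y [? ?]; rewrite -FE.
have [g1 [g2 [sg1 sg2 g12]]] := splitting _ _ _ oW (oU m) (hcontr m k0) sF.
have key (i : 'I_n) x : (i < k)%N -> U i x -> U m x ->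
    g1 x * (h i x * f i m x) = g2 x.
  by move=> ik Ui Um; rewrite -(FE i)// g12//; split=> //; exists i.
exists (fun (i : 'I_n) x => if (i < k)%N then g1 x * h i x else g2 x).
split=> [i|i j x].
  move=> /ltS[ik|->]; last by rewrite ltnn.
  rewrite ik; apply: is_section_mul (sh i ik) => //.
  by apply: is_sectionS sg1 => x Ui; exists i.
move=> /ltS[ik|->] /ltS[jk|->] [Ui Uj]; rewrite ?ik ?jk ?ltnn.
- by rewrite -mulrA hf.
- by rewrite -mulrA key.
- by rewrite -(key j)// -!mulrA cf.2// hf.
- by rewrite cocycle_diag// mulr1.
Qed.

Lemma cocycle_trivial (f : 'I_n -> 'I_n -> X -> A) :
  (forall k : 'I_n, (0 < k)%N ->
     contractible R
       (set_type ((\bigcup_(j in [set j : 'I_n | (j < k)%N]) U j) `&` U k))) ->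
  is_cocycle U f -> H1_one U f.
Proof.
move=> hcontr cf; split=> //.
have [h [sh hf]] := cocycle_trivial_upto _ _ hcontr cf (leqnn n).
exists h; split=> [i|i j x Uij]; first exact: sh.
by apply/ginv_mulP; [case: (sh i) => // _; apply; case: Uij|exact: hf].
Qed.

(** If f_ij = k_i^-1 k_j and g_ij = h_i^-1 h_j, the sections k_i^-1 h_i
    transform f into g. *)
Lemma H1_one_class (f : 'I_n -> 'I_n -> X -> A) :
  H1_one U f -> H1_one U `<=` cocycle_class U f.
Proof.
move=> [_ [k [sk fk]]] g [cg [h [sh gh]]]; split=> //.
exists (fun i x => ginv (k i x) * h i x); split=> [i|i j x Uij].
  by apply: is_section_mul => //; exact: is_section_ginv.
have [Ui Uj] := Uij.
have [kiK kKi] := ginvP _ ((sk i).2 x Ui).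
have [kjK kKj] := ginvP _ ((sk j).2 x Uj).
have [hiK hKi] := ginvP _ ((sh i).2 x Ui).
have -> : ginv (ginv (k i x) * h i x) = ginv (h i x) * k i x.
  apply: (@is_inverse_unique _ (ginv (k i x) * h i x)).
    apply: ginvP; apply: invertiblesM; last exact: (sh i).2.
    exact/ginv_invertible/(sk i).2.
  split; rewrite mulrA.
    by rewrite -[_ * k i x * _]mulrA kKi mulr1.
  by rewrite -[_ * h i x * _]mulrA hKi mulr1.
rewrite gh// fk// !mulrA -[_ * k i x * _]mulrA kKi mulr1.
by rewrite -[_ * k j x * _]mulrA kKj mulr1.
Qed.

End Cocycles.

Theorem mainTheorem2 (R : realType) (X : metricType R)
    (A : banachAlgType R[i]) (n : nat) (U : 'I_n -> set X)
    (hX : sigma_compact X)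
    (hn : (0 < n)%N)
    (hU : forall k : 'I_n, open (U k))
    (hcontr : forall k : 'I_n, (0 < k)%N ->
       contractible R
         (set_type ((\bigcup_(j in [set j : 'I_n | (j < k)%N]) U j) `&` U k))) :
  H1 (A := A) U = [set H1_one (A := A) U].
Proof.
have class_one f : is_cocycle (A := A) U f -> cocycle_class U f = H1_one U.
  move=> cf; apply/seteqP; split=> [g [cg _]|]; first exact: cocycle_trivial.
  exact/H1_one_class/cocycle_trivial.
apply/seteqP; split=> [_ [f cf <-]|_ ->]; first exact: class_one.
have c1 : is_cocycle (A := A) U (fun _ _ _ => 1).
  by split=> [i j|i j k x _]; [exact: is_section1|rewrite mulr1].
by exists (fun _ _ _ => 1) => //; exact: class_one.
Qed.
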